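(* Let $m \geq 1$, let $k = 2m+3$, and let $G$ be a connected $SC_k$ graph. Then every minimal vertex separator of $G$ has cardinality at most $2$.
   Context: All graphs are finite, simple and undirected. A graph $G$ is an $SC_k$ graph if either $G$ has no cycle, or every induced cycle of $G$ has length exactly $k$. For non-adjacent vertices $u,v$, a set $R \subset V(G)$ is a $(u,v)$-vertex separator if $u$ and $v$ lie in different connected components of $G - R$; it is a minimal $(u,v)$-vertex separator if no proper subset of $R$ is a $(u,v)$-vertex separator. A minimal vertex separator of $G$ is a set that is a minimal $(u,v)$-vertex separator for some pair of non-adjacent vertices $u,v$. *)

(* Defs.v *)
(* A finite simple graph on T : finType is given by its
   adjacency relation e : rel T, assumed symmetric and irreflexive. *)
From mathcomp Require Import all_boot.

Set Implicit Arguments.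
Unset Strict Implicit.
Unset Printing Implicit Defensive.

Definition simple_graph (T : finType) (e : rel T) : Prop :=
  symmetric e /\ irreflexive e.

Definition connected_graph (T : finType) (e : rel T) : Prop :=
  forall x y : T, connect e x y.

(* A cycle is listed by its distinct vertices in cyclic order, so its length
   is size c. The bound excludes the one- and two-vertex closed sequences that
   ucycleb would otherwise allow. *)
Definition graph_cycle (T : finType) (e : rel T) (c : seq T) : bool :=
  (2 < size c) && ucycleb e c.

(* The only edges of the graph between vertices of c are the edges of c.
   Triangles are therefore induced cycles. *)
Definition induced_cycle (T : finType) (e : rel T) (c : seq T) : Prop :=
  graph_cycle e c /\
  {in c &, forall x y, e x y -> y = next c x \/ x = next c y}.

Definition SC_graph (T : finType) (k : nat) (e : rel T) : Prop :=
  (forall c : seq T, ~~ graph_cycle e c) \/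
  (forall c : seq T, induced_cycle e c -> size c = k).

(* The edges of G - R. Vertices of R stay in the carrier type as isolated
   points, so membership in G - R has to be required separately. *)
Definition del_vertices (T : finType) (e : rel T) (R : {set T}) : rel T :=
  [rel x y | [&& x \notin R, y \notin R & e x y]].

Definition separator (T : finType) (e : rel T) (u v : T) (R : {set T}) : bool :=
  [&& u \notin R, v \notin R & ~~ connect (del_vertices e R) u v].

Definition minimal_vertex_separator (T : finType) (e : rel T) (R : {set T}) :
    Prop :=
  exists u v : T, [/\ u != v, ~~ e u v & minset (separator e u v) R].

(* Main.v *)
(* Let a, b, c be three vertices of the separator R, and let X, Y be the
   components of u and v in G - R; each of a, b, c has a neighbour in both.
   Chordless a-b paths through X and through Y close up to an induced cycle, so
   their lengths add up to k if a and b are not adjacent, and both lengths are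
   k - 1 if they are adjacent.  In X choose a Steiner point t, minimising the
   sum of the distances x, y, z to a, b, c.  Geodesics from t to a, b, c
   then have no chords between them: by minimality a chord would create a
   triangle, or join the end of a leg of length 1 to another leg, and in the
   latter case the other two legs would form a chordless path of length at
   least k.  So the pairs are joined through X by chordless paths of lengths
   x + y, y + z, x + z, and likewise through Y.  As k is odd and G has no
   triangle, these equations have no positive solution. *)
Require Import Defs.
From mathcomp Require Import all_boot.
From mathcomp Require Import zify.

Set Implicit Arguments.
Unset Strict Implicit.
Unset Printing Implicit Defensive.

(** * Cycles given by vertex functions *)

Section ShortCycles.

Variables (T : finType) (e : rel T).
Hypotheses (e_sym : symmetric e) (e_irr : irreflexive e).

Variable k : nat.
Hypothesis k_gt3 : 3 < k.
Hypothesis induced_size : forall c : seq T, induced_cycle e c -> size c = k.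

(* Paths and cycles are given by their vertex functions nat -> T together with
   a length; values beyond the length are irrelevant. *)
Lemma induced_cycle_length (g : nat -> T) (n : nat) :
  2 < n ->
  (forall i, i.+1 < n -> e (g i) (g i.+1)) -> e (g n.-1) (g 0) ->
  (forall i j, i < j < n ->
     g i <> g j /\ (e (g i) (g j) -> j = i.+1 \/ (i = 0 /\ j = n.-1))) ->
  n = k.
Proof.
case: n => // n n_gt2 g_edge g_close g_chord.
rewrite -(size_mkseq g n.+1); apply: induced_size.
have g_inj : {in gtn n.+1 &, injective g}.
  move=> i j; rewrite !inE => lti ltj eq_g.
  case: (ltngtP i j) => // lt_ij; first by have [|] := g_chord i j; [lia|].
  by have [|] := g_chord j i; [lia|rewrite eq_g].
have g_uniq : uniq (mkseq g n.+1) by apply/mkseq_uniqP.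
have g_mem x : x \in mkseq g n.+1 -> exists2 i, i < n.+1 & x = g i.
  by case/mapP=> i; rewrite mem_iota => lti ->; exists i.
have g_next i : i < n.+1 ->
    next (mkseq g n.+1) (g i) = if i < n then g i.+1 else g 0.
  move=> lti; have index_g : index (g i) (mkseq g n.+1) = i.
    rewrite -{1}(nth_mkseq (g 0) g lti).
    by apply: index_uniq g_uniq; rewrite size_mkseq.
  (* [next] looks up the tail of the list with its head as default value, so the last index wraps
     round to [g 0]. *)
  transitivity (nth (g 0) (map g (iota 1 n)) (index (g i) (mkseq g n.+1))).
    by rewrite next_nth map_f // mem_iota.
  rewrite index_g.
  case: ltnP => le_i; first by rewrite (nth_map 0) ?size_iota // nth_iota.
  by rewrite nth_default // size_map size_iota.
split.
  rewrite /graph_cycle size_mkseq n_gt2 /ucycleb g_uniq andbT /=.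
  apply/(pathP (g 0)) => i; rewrite size_rcons size_map size_iota => lti.
  rewrite -rcons_cons (nth_rcons _ (g 0 :: _)) nth_rcons /= size_map size_iota.
  rewrite lti (nth_mkseq _ g lti).
  case: ltngtP => [lt_in||eq_in].
  - by rewrite (nth_map 0) ?size_iota // nth_iota //; apply: g_edge.
  - lia.
  by rewrite eq_in.
move=> x y /g_mem[i lti ->] /g_mem[j ltj ->] e_ij; rewrite !g_next //.
case: (ltngtP i j) => [lt_ij|lt_ji|eq_ij].
- have [|_ /(_ e_ij)[->|[-> ->]]] := g_chord i j; first lia.
    by left; rewrite ifT //; lia.
  by right; rewrite ltnn.
- rewrite e_sym in e_ij.
  have [|_ /(_ e_ij)[->|[-> ->]]] := g_chord j i; first lia.
    by right; rewrite ifT //; lia.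
  by left; rewrite ltnn.
by rewrite eq_ij e_irr in e_ij.
Qed.

(** A triangle has no room for chords, so it would be an induced cycle of length 3 < k. *)
Lemma triangle_free x y z : e x y -> e y z -> e z x -> False.
Proof.
move=> exy eyz ezx; have neq u v : e u v -> u <> v.
  by move=> euv eq_uv; rewrite eq_uv e_irr in euv.
have : 3 = k; last lia.
apply: (@induced_cycle_length (nth x [:: x; y; z])) => //.
- by case=> [|[|]].
move=> [|[|[|i]]] [|[|[|j]]] //= ltij; try lia;
  split; try by [left | right | apply: neq].
by apply: nesym; apply: neq.
Qed.

(** * Chordless paths and the induced cycles they close *)

(* The end vertices are allowed to be adjacent. *)
Record chordless (X : {set T}) (a b : T) (g : nat -> T) (n : nat) : Prop :=
  Chordless {
    chordless_gt1 : 1 < n;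
    chordless_head : g 0 = a;
    chordless_last : g n = b;
    chordless_mem : forall i, 0 < i < n -> g i \in X;
    chordless_edge : forall i, i < n -> e (g i) (g i.+1);
    chordless_chord : forall i j, i < j <= n -> 0 < i \/ j < n ->
      g i <> g j /\ (e (g i) (g j) -> j = i.+1) }.

Lemma chordless_rev X a b g n :
  chordless X a b g n -> chordless X b a (fun i => g (n - i)) n.
Proof.
move=> [n_gt1 g0 gn g_mem g_edge g_chord]; split=> //.
- by rewrite subn0.
- by rewrite subnn.
- by move=> i lti; apply: g_mem; lia.
- move=> i lti; rewrite e_sym.
  by have -> : n - i = (n - i.+1).+1 by [lia]; apply: g_edge; lia.
move=> i j ltij ends.
have [||ne imp] := g_chord (n - j) (n - i); [lia | lia |].
by split; [apply: nesym | rewrite e_sym => /imp; lia].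
Qed.

(** The edge between the ends closes the path to an induced cycle on n + 1 vertices. *)
Lemma chordless_adjacent X a b g n :
  a <> b -> e a b -> chordless X a b g n -> n.+1 = k.
Proof.
move=> ne_ab e_ab [n_gt1 g0 gn g_mem g_edge g_chord].
apply: (@induced_cycle_length g) => //; first by rewrite /= gn g0 e_sym.
move=> i j ltij; case: (posnP i) => [i0|i_gt0]; last first.
  by have [||ne imp] := g_chord i j; [lia|lia|split=> // /imp; left].
case: (ltngtP j n) => [lt_jn||eq_jn]; first last.
- by rewrite i0 eq_jn g0 gn; split=> // _; right.
- lia.
by have [||ne imp] := g_chord i j; [lia|lia|split=> // /imp; left].
Qed.

(** Following g from a to b and h back to a gives a cycle on n + p vertices. A chord would have to
    join the two interiors, which [sepXY] forbids, or the two ends. *)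
Lemma chordless_nonadjacent (X Y : {set T}) a b g n h p :
  {in X & Y, forall s s', s <> s' /\ ~~ e s s'} ->
  a <> b -> ~~ e a b -> chordless X a b g n -> chordless Y a b h p ->
  n + p = k.
Proof.
move=> sepXY ne_ab ne_e gP /chordless_rev.
case: gP => n_gt1 g0 gn g_mem g_edge g_chord.
move: (fun i => h (p - i)) => {}h [p_gt1 h0 hp h_mem h_edge h_chord].
apply: (@induced_cycle_length (fun i => if i <= n then g i else h (i - n))).
- lia.
- move=> i lti; case: (leqP i.+1 n) => lt_in.
    by rewrite ifT; [apply: g_edge | lia].
  have -> : i.+1 - n = (i - n).+1 by lia.
  case: ifP => le_in; last by apply: h_edge; lia.
  by have -> : i = n by [lia]; rewrite gn -h0 subnn; apply: h_edge; lia.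
- rewrite ifF; last lia.
  rewrite leq0n g0 -hp; have {2}-> : p = ((n + p).-1 - n).+1 by lia.
  by apply: h_edge; lia.
move=> i j ltij; case: (leqP j n) => le_jn.
  rewrite ifT; last lia.
  case: (posnP i) => [i0|i_gt0]; last first.
    by have [||ne imp] := g_chord i j; [lia|lia|split=> // /imp; left].
  case: (ltngtP j n) => [lt_jn||eq_jn]; first last.
  - by rewrite i0 eq_jn g0 gn; split=> // eab; rewrite eab in ne_e.
  - lia.
  by have [||ne imp] := g_chord i j; [lia|lia|split=> // /imp; left].
case: (leqP i n) => le_in; last first.
  by have [||ne imp] := h_chord (i - n) (j - n);
    [lia|lia|split=> // /imp; left; lia].
(* The vertex a is also the last one of the reversed h, so its edges to h are governed by the chord
   condition of h. *)
case: (posnP i) => [i0|i_gt0].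
  have [||ne imp] := h_chord (j - n) p; [lia|lia|].
  rewrite i0 g0 -hp e_sym; split; first exact: nesym.
  by move/imp=> ?; right; lia.
case: (ltngtP i n) => [lt_in||eq_in]; last 1 first.
- have [||ne imp] := h_chord 0 (j - n); [lia|lia|].
  by rewrite eq_in gn -h0; split=> // /imp ?; left; lia.
- have gX : g i \in X by apply: g_mem; lia.
  have hY : h (j - n) \in Y by apply: h_mem; lia.
  by have [ne /negPf->] := sepXY _ _ gX hY.
lia.
Qed.

(** * Distances and geodesics *)

(* f s is the length of a shortest path from s in X to a whose vertices other
   than a lie in X. *)
Record distance_to (X : {set T}) (a : T) (f : T -> nat) : Prop :=
  DistanceTo {
    distance_gt0 : {in X, forall s, 0 < f s};
    distance_lip : {in X &, forall s s', e s s' -> f s <= (f s').+1};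
    distance_edge : {in X, forall s, e s a = (f s == 1)};
    distance_step : {in X, forall s, 1 < f s ->
      exists s', [/\ s' \in X, e s s' & f s = (f s').+1]} }.

(** Connectedness is stated as an induction principle, which avoids handling paths inside X. *)
Definition connected_set (X : {set T}) : Prop :=
  forall P : T -> Prop, (exists2 s, s \in X & P s) ->
  {in X &, forall s s', e s s' -> P s -> P s'} -> {in X, forall s, P s}.

Lemma distance_exists X a :
  connected_set X -> (exists2 s, s \in X & e s a) ->
  exists f, distance_to X a f.
Proof.
move=> connX [s0 s0X e_s0a].
(* [lev n s] means that n steps inside X lead from s to a neighbour of a. The distance is therefore
   one more than the least such n. *)
pose fix lev n s {struct n} : bool :=
  if n is n'.+1 then [exists s', [&& s' \in X, e s s' & lev n' s']] else e s a.
have levS n s s' : s' \in X -> e s s' -> lev n s' -> lev n.+1 s.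
  by move=> s'X ess' levs'; apply/existsP; exists s'; rewrite s'X ess'.
have lev_ex : {in X, forall s, exists n, lev n s}.
  apply: connX; first by exists s0 => //; exists 0.
  move=> s s' sX s'X ess' [n levs]; exists n.+1.
  by apply: levS levs; rewrite 1?e_sym.
have /fin_all_exists[f fP] s : exists n,
    s \in X -> lev n s /\ forall m, lev m s -> n <= m.
  case sX: (s \in X); last by exists 0.
  by have [n lev_s min_s] := ex_minnP (lev_ex _ sX); exists n.
exists (fun s => (f s).+1); split=> //.
- move=> s s' sX s'X ess'; rewrite ltnS.
  by apply: (fP s sX).2; apply: levS ess' (fP s' s'X).1.
- move=> s sX; have [lev_s min_s] := fP s sX; rewrite eqSS; apply/idP/eqP.
    by move=> /(min_s 0); lia.
  by move=> f0; rewrite f0 in lev_s.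
move=> s sX; have [lev_s min_s] := fP s sX; rewrite ltnS.
case def_n: (f s) lev_s => [//|n] /= /existsP[s' /and3P[s'X ess' lev_s']] _.
exists s'; split=> //; congr _.+2; apply/eqP; rewrite eqn_leq.
have [levf min_s'] := fP s' s'X; rewrite min_s' // andbT -ltnS -def_n.
exact: min_s (levS _ _ _ s'X ess' levf).
Qed.

Record geodesic (X : {set T}) (a : T) (f : T -> nat) (t : T) (g : nat -> T) :
    Prop := Geodesic {
  geodesic_head : g 0 = t;
  geodesic_last : g (f t) = a;
  geodesic_mem : forall i, i < f t -> g i \in X;
  geodesic_dist : forall i, i < f t -> f (g i) = f t - i;
  geodesic_edge : forall i, i < f t -> e (g i) (g i.+1) }.

Lemma geodesic_exists X a f t :
  distance_to X a f -> t \in X -> exists g, geodesic X a f t g.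
Proof.
move=> fP; move def_n: (f t) => n; elim: n t def_n => [|n IHn] t ft tX.
  by have := distance_gt0 fP tX; rewrite ft.
case: n => [|n] in ft IHn *.
  exists (fun i => if i is 0 then t else a); split; rewrite ?ft //.
  - by case.
  - by case.
  by case=> //= _; rewrite (distance_edge fP) // ft.
have [|s' [s'X ets' fs']] := distance_step fP tX; first by rewrite ft.
have [|g [g0 gl g_mem g_dist g_edge]] := IHn s' _ s'X; first lia.
have {}fs' : f s' = n.+1 by lia.
exists (fun i => if i is i'.+1 then g i' else t); split; rewrite ?ft //.
- by rewrite -gl fs'.
- by case=> // i lti; apply: g_mem; lia.
- by case=> // i lti; rewrite g_dist; lia.
case=> [|i] lti; first by rewrite g0.
by apply: g_edge; lia.
Qed.

(** Among the neighbours of a in X take one closest to b and put a in front of its geodesic. A later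
    neighbour of a inside X on that geodesic would be closer still. *)
Lemma chordless_exists X a b :
  connected_set X -> a \notin X -> b \notin X ->
  (exists2 s, s \in X & e s a) -> (exists2 s, s \in X & e s b) ->
  exists g n, chordless X a b g n.
Proof.
move=> connX aX bX [s0 s0X es0a] /(distance_exists connX)[f fP].
have P0 : (s0 \in X) && e s0 a by rewrite s0X.
pose t := [arg min_(s < s0 | (s \in X) && e s a) f s].
have [/andP[tX eta] min_t] : (t \in X) && e t a /\
    forall s, (s \in X) && e s a -> f t <= f s.
  by rewrite /t; case: arg_minnP.
have [g [g0 gl g_mem g_dist g_edge]] := geodesic_exists fP tX.
have ft := distance_gt0 fP tX.
exists (fun i => if i is i'.+1 then g i' else a), (f t).+1; split=> //.
- by case=> // i lti; apply: g_mem; lia.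
- case=> [|i] lti; first by rewrite g0 e_sym.
  by apply: g_edge; lia.
case=> [|i] [|j] // ltij ends.
  have gjX : g j \in X by apply: g_mem; lia.
  split; first by move=> eq_a; rewrite eq_a gjX in aX.
  rewrite e_sym => e_gja; have := min_t (g j); rewrite gjX e_gja g_dist; lia.
have giX : g i \in X by apply: g_mem; lia.
have [eq_j|lt_j] : j = f t \/ j < f t by lia.
  rewrite eq_j gl; split; first by move=> eq_b; rewrite -eq_b giX in bX.
  by rewrite (distance_edge fP) // g_dist; lia.
have gjX : g j \in X by apply: g_mem.
split; first by move/(congr1 f); rewrite !g_dist; lia.
by move/(distance_lip fP giX gjX); rewrite !g_dist; lia.
Qed.

(** * Legs from a Steiner point *)

Record leg (X : {set T}) (t a : T) (f : T -> nat) (g : nat -> T) : Prop :=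
  Leg {
    leg_start : t \in X;
    leg_end : a \notin X;
    leg_dist : distance_to X a f;
    leg_geo : geodesic X a f t g }.

Section Legs.

Variables (X : {set T}) (t : T).

Lemma leg_exists a f :
  a \notin X -> t \in X -> distance_to X a f -> exists g, leg X t a f g.
Proof. by move=> aX tX fP; have [g gP] := geodesic_exists fP tX; exists g. Qed.

Lemma leg_gt0 a f g : leg X t a f g -> 0 < f t.
Proof. by case=> tX _ fP _; apply: distance_gt0 fP _ tX. Qed.

Lemma leg_chord a f g : leg X t a f g -> forall i j, i < j <= f t ->
  g i <> g j /\ (e (g i) (g j) -> j = i.+1).
Proof.
case=> tX aX fP [g0 gl g_mem g_dist g_edge] i j ltij.
have giX : g i \in X by apply: g_mem; lia.
have [eq_j|lt_j] : j = f t \/ j < f t by lia.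
  rewrite eq_j gl; split; first by move=> eq_a; rewrite -eq_a giX in aX.
  by rewrite (distance_edge fP) // g_dist; lia.
have gjX : g j \in X by apply: g_mem.
split; first by move/(congr1 f); rewrite !g_dist; lia.
by move/(distance_lip fP giX gjX); rewrite !g_dist; lia.
Qed.

Arguments leg_chord [a f g] _ i j _.

Lemma leg_lip a f g c h B : leg X t a f g -> leg X t c h B ->
  forall i, i < f t -> h (g i) <= h t + i.
Proof.
case=> tX aX fP [g0 gl g_mem g_dist g_edge] [_ _ hP _].
elim=> [|i IHi] lti; first by rewrite g0 addn0.
have := distance_lip hP (g_mem _ lti) (g_mem _ (ltnW lti)).
by rewrite e_sym g_edge; [move/(_ isT); have := IHi (ltnW lti); lia | lia].
Qed.

(** Index 0 is left out because the legs share t, and the pair of both last indices because the ends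
    of the legs may be adjacent. *)
Definition legs_apart (m n : nat) (A B : nat -> T) : Prop :=
  forall i j, 0 < i <= m -> 0 < j <= n -> i < m \/ j < n ->
  A i <> B j /\ ~~ e (A i) (B j).

Lemma chordless_cat a b fa fb A B :
  leg X t a fa A -> leg X t b fb B -> legs_apart (fa t) (fb t) A B ->
  chordless X a b (fun i => if i <= fa t then A (fa t - i) else B (i - fa t))
    (fa t + fb t).
Proof.
move=> legA legB apart.
have [tX aX faP [A0 Al A_mem A_dist A_edge]] := legA.
have [_ bX fbP [B0 Bl B_mem B_dist B_edge]] := legB.
have xgt0 := leg_gt0 legA; have ygt0 := leg_gt0 legB.
set x := fa t in Al A_mem A_dist A_edge xgt0 apart *.
set y := fb t in Bl B_mem B_dist B_edge ygt0 apart *.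
split.
- lia.
- by rewrite leq0n subn0.
- by rewrite ifF; [rewrite addKn | lia].
- by move=> i lti; case: leqP => le_ix; [apply: A_mem; lia | apply: B_mem; lia].
- move=> i lti; case: (leqP i.+1 x) => lt_ix.
    rewrite ifT; last lia.
    have -> : x - i = (x - i.+1).+1 by lia.
    by rewrite e_sym; apply: A_edge; lia.
  have -> : i.+1 - x = (i - x).+1 by lia.
  case: ifP => le_ix; last by apply: B_edge; lia.
  have -> : i = x by lia.
  by rewrite subnn A0 -B0; apply: B_edge; lia.
move=> i j ltij ends; case: (leqP j x) => le_jx.
  rewrite ifT; last lia.
  have [|ne imp] := leg_chord legA (x - j) (x - i); first by lia.
  by rewrite e_sym; split; [apply: nesym | move/imp; lia].
case: (leqP i x) => le_ix; last first.
  have [|ne imp] := leg_chord legB (i - x) (j - x); first by lia.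
  by split=> // /imp; lia.
have [eq_ix|lt_ix] : i = x \/ i < x by lia.
  rewrite eq_ix subnn A0 -B0.
  have [|ne imp] := leg_chord legB 0 (j - x); first by lia.
  by split=> // /imp; lia.
have [|||ne /negPf->] := apart (x - i) (j - x); [lia | lia | lia |].
by split.
Qed.

Section Steiner.

Variables (a b c : T) (fa fb fc : T -> nat) (A B C : nat -> T).
Hypotheses (legA : leg X t a fa A) (legB : leg X t b fb B).
Hypothesis legC : leg X t c fc C.
Hypothesis steiner : {in X, forall s, fa t + fb t + fc t <= fa s + fb s + fc s}.

(** Compared with t, the vertex [A i] is i steps nearer to a and at most i steps farther from c, so
    by minimality it is no nearer to b. Likewise [B j] is no nearer to a. This excludes equality,
    and an edge forces i = j = 1, hence a triangle at t. *)
Lemma steiner_interior i j : 0 < i < fa t -> 0 < j < fb t ->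
  A i <> B j /\ ~~ e (A i) (B j).
Proof.
move=> lti ltj.
have [tX aX faP [A0 Al A_mem A_dist A_edge]] := legA.
have [_ bX fbP [B0 Bl B_mem B_dist B_edge]] := legB.
have AiX : A i \in X by apply: A_mem; lia.
have BjX : B j \in X by apply: B_mem; lia.
have fcA : fc (A i) <= fc t + i by apply: leg_lip legA legC _ _; lia.
have := steiner AiX.
have fcB : fc (B j) <= fc t + j by apply: leg_lip legB legC _ _; lia.
have := steiner BjX.
rewrite A_dist ?B_dist; try lia; move=> minB minA.
split.
  by move=> eqAB; rewrite eqAB B_dist in minA fcA; lia.
apply/negP=> eAB; have eBA := eAB; rewrite e_sym in eBA.
have := distance_lip fbP AiX BjX eAB; have := distance_lip faP BjX AiX eBA.
rewrite A_dist ?B_dist; try lia; move=> lipa lipb.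
have i1 : i = 1 by lia.
have j1 : j = 1 by lia.
apply: (@triangle_free t (A 1) (B 1)).
- by rewrite -A0 A_edge //; lia.
- by move: eAB; rewrite i1 j1.
by rewrite e_sym -B0 B_edge //; lia.
Qed.

(* The first neighbour of a on B after t closes an induced cycle through a and
   t, hence sits at position k - 2. *)
Lemma steiner_attach j : 0 < j < fb t -> e a (B j) ->
  [/\ fa t = 1, k - 2 < fb t & e a (B (k - 2))].
Proof.
move=> ltj eaB.
have [tX aX faP _] := legA.
have [_ bX fbP [B0 Bl B_mem B_dist B_edge]] := legB.
have BjX : B j \in X by apply: B_mem; lia.
have fcB : fc (B j) <= fc t + j by apply: leg_lip legB legC _ _; lia.
(* Moving from t to [B j] does not increase the sum of the distances to b and c, so minimality gives
   [fa t <= fa (B j) = 1]. *)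
have := steiner BjX.
have : fa (B j) == 1 by rewrite -(distance_edge faP) // e_sym.
rewrite B_dist; last lia; move=> faB minB.
have xgt0 := leg_gt0 legA.
have x1 : fa t = 1 by lia.
have eta : e t a by rewrite (distance_edge faP) // x1.
have : exists j0, (0 < j0) && e a (B j0) by exists j; rewrite eaB; lia.
case/ex_minnP=> j0 /andP[j0_gt0 eaBj0] min_j0.
have le_j0 : j0 <= j by apply: min_j0; rewrite eaB; lia.
suff eq_k : j0.+2 = k by have -> : k - 2 = j0 by [lia]; split=> //; lia.
apply: (@induced_cycle_length (fun i => if i is i'.+1 then B i' else a)).
- lia.
- case=> [|i] lti; first by rewrite B0 e_sym.
  by apply: B_edge; lia.
- by rewrite /= e_sym.
case=> [|i] [|i'] // lti.
  have BX : B i' \in X by apply: B_mem; lia.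
  split; first by move=> eq_a; rewrite eq_a BX in aX.
  have [->|i'_gt0] := posnP i'; first by left.
  move=> eaBi'; have := min_j0 i'; rewrite eaBi' i'_gt0 => /(_ isT) ?.
  by right; lia.
have [|ne imp] := leg_chord legB i i'; first by lia.
by split=> // /imp; lia.
Qed.

End Steiner.

(* Otherwise a is a neighbour of t, and B has length at least k - 1.  By
   minimality, c is then not attached to B, nor b to C, so C followed by B is
   a chordless path of length at least k. *)
Lemma steiner_not_attached a b c fa fb fc A B C :
  leg X t a fa A -> leg X t b fb B -> leg X t c fc C ->
  {in X, forall s, fa t + fb t + fc t <= fa s + fb s + fc s} ->
  (forall g n, chordless X b c g n -> n < k) ->
  forall j, 0 < j < fb t -> ~~ e a (B j).
Proof.
move=> legA legB legC minF bound j ltj; apply/negP => eaBj.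
have [x1 lt_k eaBk] := steiner_attach legA legB legC minF ltj eaBj.
have minBCA : {in X, forall s, fb t + fc t + fa t <= fb s + fc s + fa s}.
  by move=> s /minF; lia.
have minCBA : {in X, forall s, fc t + fb t + fa t <= fc s + fb s + fa s}.
  by move=> s /minF; lia.
have [tX aX faP _] := legA.
have [_ bX fbP [B0 Bl B_mem B_dist _]] := legB.
have [_ cX fcP [C0 Cl C_mem _ _]] := legC.
have ygt0 := leg_gt0 legB; have zgt0 := leg_gt0 legC.
suff apart : legs_apart (fb t) (fc t) B C.
  by have := bound _ _ (chordless_cat legB legC apart); lia.
move=> i l lti ltl ends.
have [eq_i|lt_i] : i = fb t \/ i < fb t by lia.
  have ClX : C l \in X by apply: C_mem; lia.
  rewrite eq_i Bl; split; first by move=> eq_b; rewrite eq_b ClX in bX.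
  (* An attachment of b to C would put b next to t, but [fb t] exceeds k - 2. *)
  apply/negP=> ebC.
  by have [|y1 _ _] := steiner_attach legB legC legA minBCA _ ebC; lia.
have BiX : B i \in X by apply: B_mem; lia.
have [eq_l|lt_l] : l = fc t \/ l < fc t by lia.
  rewrite eq_l Cl e_sym; split; first by move=> eq_c; rewrite -eq_c BiX in cX.
  apply/negP=> ecB.
  (* Both attachments occur at the same vertex [B (k - 2)], which is adjacent to a and to c and k -
     2 steps nearer to b than t, against minimality. *)
  have [|_ _ ecBk] := steiner_attach legC legB legA minCBA _ ecB; first lia.
  have BkX : B (k - 2) \in X by apply: B_mem.
  have := minF _ BkX; rewrite B_dist //.
  have /eqP-> : fa (B (k - 2)) == 1 by rewrite -(distance_edge faP) // e_sym.
  have /eqP-> : fc (B (k - 2)) == 1 by rewrite -(distance_edge fcP) // e_sym.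
  lia.
apply: (steiner_interior legB legC legA minBCA); clear -lti ltl lt_i lt_l; lia.
Qed.

(** Either both vertices are interior, or one is the end of its leg. An end is kept off the other
    leg by the length bound for that leg paired with C. *)
Lemma steiner_apart a b c fa fb fc A B C :
  leg X t a fa A -> leg X t b fb B -> leg X t c fc C ->
  {in X, forall s, fa t + fb t + fc t <= fa s + fb s + fc s} ->
  (forall g n, chordless X b c g n -> n < k) ->
  (forall g n, chordless X a c g n -> n < k) ->
  legs_apart (fa t) (fb t) A B.
Proof.
move=> legA legB legC minF bound_bc bound_ac i j lti ltj ends.
have minBAC : {in X, forall s, fb t + fa t + fc t <= fb s + fa s + fc s}.
  by move=> s /minF; lia.
have [tX aX _ [_ Al A_mem _ _]] := legA.
have [_ bX _ [_ Bl B_mem _ _]] := legB.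
have [eq_i|lt_i] : i = fa t \/ i < fa t by lia.
  have BjX : B j \in X by apply: B_mem; lia.
  rewrite eq_i Al; split; first by move=> eq_a; rewrite eq_a BjX in aX.
  by apply: (steiner_not_attached legA legB legC minF) => //; lia.
have AiX : A i \in X by apply: A_mem; lia.
have [eq_j|lt_j] : j = fb t \/ j < fb t by lia.
  rewrite eq_j Bl e_sym; split; first by move=> eq_b; rewrite -eq_b AiX in bX.
  by apply: (steiner_not_attached legB legA legC minBAC) => //; lia.
by apply: (steiner_interior legA legB legC minF); lia.
Qed.

End Legs.

(** * Three vertices attached to two separated connected sets *)

Lemma steiner_paths X a b c :
  connected_set X -> a \notin X -> b \notin X -> c \notin X ->
  (exists2 s, s \in X & e s a) -> (exists2 s, s \in X & e s b) ->
  (exists2 s, s \in X & e s c) ->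
  (forall g n, chordless X a b g n -> n < k) ->
  (forall g n, chordless X b c g n -> n < k) ->
  (forall g n, chordless X a c g n -> n < k) ->
  exists x y z, [/\ [/\ 0 < x, 0 < y & 0 < z],
    exists g, chordless X a b g (x + y), exists g, chordless X b c g (y + z)
    & exists g, chordless X a c g (x + z)].
Proof.
move=> connX aX bX cX na nb nc bound_ab bound_bc bound_ac.
have [fa faP] := distance_exists connX na.
have [fb fbP] := distance_exists connX nb.
have [fc fcP] := distance_exists connX nc.
have [s0 s0X _] := na.
pose t := [arg min_(s < s0 in X) (fa s + fb s + fc s)].
have [tX minF] : t \in X /\
    {in X, forall s, fa t + fb t + fc t <= fa s + fb s + fc s}.
  by rewrite /t; case: arg_minnP.
have [A legA] := leg_exists aX tX faP.
have [B legB] := leg_exists bX tX fbP.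
have [C legC] := leg_exists cX tX fcP.
have minBCA : {in X, forall s, fb t + fc t + fa t <= fb s + fc s + fa s}.
  by move=> s /minF; lia.
have minACB : {in X, forall s, fa t + fc t + fb t <= fa s + fc s + fb s}.
  by move=> s /minF; lia.
have rev p q : (forall g n, chordless X p q g n -> n < k) ->
    forall g n, chordless X q p g n -> n < k.
  by move=> bound g n /chordless_rev; apply: bound.
exists (fa t), (fb t), (fc t); split.
- by split; [exact: leg_gt0 legA | exact: leg_gt0 legB | exact: leg_gt0 legC].
- eexists; apply: (chordless_cat legA legB).
  exact: (steiner_apart legA legB legC minF bound_bc bound_ac).
- eexists; apply: (chordless_cat legB legC).
  exact: (steiner_apart legB legC legA minBCA
    (rev _ _ bound_ac) (rev _ _ bound_ab)).
eexists; apply: (chordless_cat legA legC).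
exact: (steiner_apart legA legC legB minACB (rev _ _ bound_bc) bound_ab).
Qed.

Lemma no_three_attachments (X Y : {set T}) a b c :
  odd k ->
  {in X & Y, forall s s', s <> s' /\ ~~ e s s'} ->
  connected_set X -> connected_set Y ->
  a <> b -> b <> c -> a <> c ->
  (forall r, r \in [:: a; b; c] -> [/\ r \notin X, r \notin Y,
     exists2 s, s \in X & e s r & exists2 s, s \in Y & e s r]) ->
  False.
Proof.
move=> k_odd sepXY connX connY ne_ab ne_bc ne_ac nbr.
have [aX aY naX naY] : [/\ a \notin X, a \notin Y,
   exists2 s, s \in X & e s a & exists2 s, s \in Y & e s a].
  by apply: nbr; rewrite !inE eqxx.
have [bX bY nbX nbY] : [/\ b \notin X, b \notin Y,
   exists2 s, s \in X & e s b & exists2 s, s \in Y & e s b].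
  by apply: nbr; rewrite !inE eqxx orbT.
have [cX cY ncX ncY] : [/\ c \notin X, c \notin Y,
   exists2 s, s \in X & e s c & exists2 s, s \in Y & e s c].
  by apply: nbr; rewrite !inE eqxx !orbT.
have sum p q g n h l : p <> q -> chordless X p q g n -> chordless Y p q h l ->
    if e p q then n.+1 = k /\ l.+1 = k else n + l = k.
  move=> ne_pq gP hP; case: ifP => [epq|/negbT nepq].
    by rewrite (chordless_adjacent ne_pq epq gP)
               (chordless_adjacent ne_pq epq hP).
  exact: (chordless_nonadjacent sepXY ne_pq nepq gP hP).
(* A chordless path through the other set exists and has length at least 2, so the relation [sum]
   yields the strict bounds required by [steiner_paths]. *)
have bounds p q : p <> q ->
    p \notin X -> p \notin Y -> q \notin X -> q \notin Y ->
    (exists2 s, s \in X & e s p) -> (exists2 s, s \in X & e s q) ->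
    (exists2 s, s \in Y & e s p) -> (exists2 s, s \in Y & e s q) ->
    (forall g n, chordless X p q g n -> n < k) /\
    (forall g n, chordless Y p q g n -> n < k).
  move=> ne_pq pX pY qX qY npX nqX npY nqY.
  have [g1 [n1 P1]] := chordless_exists connX pX qX npX nqX.
  have [g2 [n2 P2]] := chordless_exists connY pY qY npY nqY.
  have gt1 := chordless_gt1 P1; have gt2 := chordless_gt1 P2.
  split=> g n gP.
    by have := sum _ _ _ _ _ _ ne_pq gP P2; clear -gt2; case: ifP; lia.
  by have := sum _ _ _ _ _ _ ne_pq P1 gP; clear -gt1; case: ifP; lia.
have [abX abY] := bounds a b ne_ab aX aY bX bY naX nbX naY nbY.
have [bcX bcY] := bounds b c ne_bc bX bY cX cY nbX ncX nbY ncY.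
have [acX acY] := bounds a c ne_ac aX aY cX cY naX ncX naY ncY.
have [x [y [z [[x0 y0 z0] [g1 P1] [g2 P2] [g3 P3]]]]] :=
  steiner_paths connX aX bX cX naX nbX ncX abX bcX acX.
have [x' [y' [z' [[x'0 y'0 z'0] [h1 Q1] [h2 Q2] [h3 Q3]]]]] :=
  steiner_paths connY aY bY cY naY nbY ncY abY bcY acY.
have := sum _ _ _ _ _ _ ne_ab P1 Q1; have := sum _ _ _ _ _ _ ne_bc P2 Q2.
have := sum _ _ _ _ _ _ ne_ac P3 Q3.
have : ~~ [&& e a b, e b c & e c a].
  by apply/and3P => -[eab ebc eca]; apply: triangle_free eab ebc eca.
(* Consider x + x', y + y' and z + z'. With no edge or exactly two edges among a, b, c, two of these
   sums are equal and add up to k, which is odd. With exactly one edge, the sum belonging to the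
   third vertex is 1, although both its terms are positive. Three edges form a triangle. *)
rewrite (e_sym c); clear -k_odd x0 y0 z0 x'0 y'0 z'0.
by case: (e a b) (e b c) (e a c) => [] [] [] //= _; lia.
Qed.

End ShortCycles.

(** * Components of G - R and minimal separators *)

Section Components.

Variables (T : finType) (e : rel T).
Hypothesis e_sym : symmetric e.

Definition component (R : {set T}) (u : T) : {set T} :=
  [set s | connect (del_vertices e R) u s].

Lemma del_vertices_sym R : symmetric (del_vertices e R).
Proof.
move=> x y; rewrite /del_vertices /= e_sym.
by case: (x \in R); case: (y \in R).
Qed.

Lemma component_disjoint (R : {set T}) u s :
  u \notin R -> s \in component R u -> s \notin R.
Proof.
move=> uR; rewrite inE => /connectP[p]; case/lastP: p => [_ -> // | p x].
by rewrite rcons_path last_rcons => /andP[_ /and3P[_ xR _]] ->.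
Qed.

Lemma component_step (R : {set T}) u s s' :
  u \notin R -> s \in component R u -> e s s' -> s' \notin R ->
  s' \in component R u.
Proof.
move=> uR sX ess' s'R; have sR := component_disjoint uR sX.
move: sX; rewrite !inE => us; apply: connect_trans us (connect1 _).
by rewrite /del_vertices /= sR s'R.
Qed.

Lemma component_connected (R : {set T}) u :
  u \notin R -> connected_set e (component R u).
Proof.
move=> uR P [s0 s0X Ps0] Pstep s sX.
have: connect (del_vertices e R) s0 s.
  move: s0X sX; rewrite !inE (sym_connect_sym (del_vertices_sym R)).
  exact: connect_trans.
case/connectP=> p; elim: p s0 s0X Ps0 => [|x p IHp] s0 s0X Ps0 /=.
  by move=> _ ->.
case/andP=> /and3P[s0R xR es0x] p_path def_s.
have xX := component_step uR s0X es0x xR.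
by apply: IHp p_path def_s => //; apply: Pstep Ps0.
Qed.

Lemma separator_sym u v R : separator e u v R = separator e v u R.
Proof.
rewrite /separator (sym_connect_sym (del_vertices_sym R)).
by case: (u \in R); case: (v \in R).
Qed.

(** If r had no neighbour in the component of u, putting r back would not enlarge that component, so
    [R :\ r] would still separate u from v. *)
Lemma minset_separator_nbr u v (R : {set T}) r :
  minset (separator e u v) R -> r \in R ->
  exists2 s, s \in component R u & e s r.
Proof.
move=> /minsetP[/and3P[uR vR not_uv] minR] rR.
case: (boolP [exists s in component R u, e s r]) => [/existsP[s /andP[]]|].
  by exists s.
rewrite negb_exists => /forallP no_nbr.
suff sep : separator e u v (R :\ r).
  by have := minR _ sep (subD1set _ _) => eqR; rewrite -eqR !inE eqxx in rR.
rewrite /separator !inE (negPf uR) (negPf vR) !andbF /=.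
have vX : v \notin component R u by rewrite inE.
apply/negP => /connectP[p].
have : u \in component R u by rewrite inE connect0.
(* The start of the walk is generalised to any vertex w of the component; a step from w cannot reach
   r, so it stays in the component. *)
elim: p {1 3 4}u => [|x p IHp] w wX /=.
  by move=> _ def_v; rewrite def_v wX in vX.
case/andP=> /and3P[_ xR ewx]; apply: IHp.
apply: (component_step uR wX ewx).
apply: contra xR => xR; rewrite !inE xR andbT.
by apply: contraTneq ewx => ->; have := no_nbr w; rewrite wX.
Qed.

End Components.

Theorem theorem1 (m k : nat) (T : finType) (e : rel T) :
  1 <= m -> k = 2 * m + 3 ->
  simple_graph e -> connected_graph e -> SC_graph k e ->
  forall R : {set T}, minimal_vertex_separator e R -> #|R| <= 2.
Proof.
move=> m_gt0 def_k [e_sym e_irr] _ SC R [u [v [_ _ minR]]].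
(* In the acyclic case the length condition holds vacuously. *)
have ind_size c : induced_cycle e c -> size c = k.
  by case: SC => [acyclic [] | SC]; [rewrite (negPf (acyclic c)) | apply: SC].
rewrite leqNgt; apply/negP => /card_gt2P[a [b [c [[aR bR cR] [ab bc ca]]]]].
have /and3P[uR vR not_uv] := minsetp minR.
have minR' : minset (separator e v u) R.
  by rewrite -(minset_eq _ (separator_sym e_sym u v)).
apply: (@no_three_attachments T e e_sym e_irr k _ ind_size
  (component e R u) (component e R v) a b c); try by [lia | apply/eqP].
(* A common vertex of the two components, or an edge between them, would connect u to v outside
   R. *)
- move=> s s' sX s'Y; have s'R := component_disjoint vR s'Y.
  have s'X : s' \notin component e R u.
    apply: contra not_uv => s'X; move: s'X s'Y; rewrite !inE.
    rewrite (sym_connect_sym (del_vertices_sym e_sym R) v).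
    exact: connect_trans.
  split; first by move=> eq_s; rewrite -eq_s sX in s'X.
  by apply: contra s'X => ess'; exact: (component_step uR sX ess').
- exact: component_connected.
- exact: component_connected.
- by apply/eqP; rewrite eq_sym.
move=> r r_abc; have rR : r \in R.
  by move: r_abc; rewrite !inE => /or3P[] /eqP->.
split.
- by apply: contraL rR; apply: component_disjoint.
- by apply: contraL rR; apply: component_disjoint.
- exact: minset_separator_nbr minR rR.
exact: minset_separator_nbr minR' rR.
Qed.
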